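(* Consider the sender-receiver game $\Gamma$ with data $(K,p,M,X,(U^k)_{k\in K},(V^k)_{k\in K},(u_0^k)_{k\in K})$ described in the context. Assume that the (compact) decision set $X$ is a real interval and that every utility function $U^k$, $k\in K$, is monotonic over $X$ (i.e., for each $k$, $U^k$ is either weakly increasing or weakly decreasing on $X$). Then $\Gamma$ has a partitional equilibrium.
   Context: Data of the game $\Gamma$. $K$ is a nonempty finite set of types; $p\in\Delta(K)$ is a prior probability with $p^k>0$ for every $k\in K$; $M$ is a finite set of messages with $|M|\ge|K|$; $X$ is a compact (topological) space of decisions; for every $k\in K$, $U^k:X\to\mathbb{R}$ (sender, player 1) and $V^k:X\to\mathbb{R}$ (receiver, player 2) are continuous utility functions and $u_0^k\in\mathbb{R}$ is the sender's outside option. It is assumed that for every $k\in K$ there exists $x\in X$ with $U^k(x)\ge u_0^k$. ($\Delta(S)$ denotes the set of probability distributions on a finite set $S$.) Interpretation: a type $k$ is drawn from $p$ and told to the sender, who sends a message $m\in M$; the receiver then proposes $x\in X$; if the sender accepts, payoffs are $U^k(x),V^k(x)$; if he rejects (exit), he gets $u_0^k$ and the receiver gets $-\infty$. The sender of type $k$ accepts $x$ if and only if $U^k(x)\ge u_0^k$. The receiver's equilibrium expected utility is required to be finite. For $L\subseteq K$ let $X(L)=\{x\in X: U^k(x)\ge u_0^k \ \forall k\in L\}$. A strategy of the sender is a map $\sigma:K\to\Delta(M)$, written $\sigma(m\mid k)$; a strategy of the receiver is a map $\tau:M\to X$. Put $P_\sigma(m)=\sum_{k}p^k\sigma(m\mid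 k)$ and, if $P_\sigma(m)>0$, $p_m^k(\sigma)=p^k\sigma(m\mid k)/P_\sigma(m)$, $p_m(\sigma)=(p_m^k(\sigma))_{k\in K}\in\Delta(K)$, with support $\mathrm{supp}\,p_m(\sigma)\subseteq K$. An equilibrium of $\Gamma$ is a pair $(\sigma,\tau)$ such that (1) (incentive compatibility) $U^k(\tau(m))\ge U^k(\tau(m'))$ for all $k\in K$, all $m\in M$ with $\sigma(m\mid k)>0$ and all $m'\in M$; (2) (constrained optimization, no exit) for every $m\in M$ with $P_\sigma(m)>0$, $X(\mathrm{supp}\,p_m(\sigma))\ne\emptyset$ and $\tau(m)\in\arg\max_{x\in X(\mathrm{supp}\,p_m(\sigma))}\sum_{k}p_m^k(\sigma)V^k(x)$. An equilibrium is partitional if $\sigma$ is pure, i.e., for every $k\in K$, $\sigma(\cdot\mid k)$ is concentrated on a single message. *)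

(* Defs.v *)
From HB Require Import structures.
From mathcomp Require Import all_boot all_order all_algebra.
From mathcomp Require Import all_classical all_reals all_analysis.

Set Implicit Arguments.
Unset Strict Implicit.
Unset Printing Implicit Defensive.

Import Order.TTheory GRing.Theory Num.Theory.
Import numFieldNormedType.Exports.
Local Open Scope classical_set_scope.
Local Open Scope ring_scope.

Definition is_dist (R : realType) (S : finType) (q : S -> R) : Prop :=
  (forall s, 0 <= q s) /\ \sum_s q s = 1.

(* The decision space is a compact subset [decisions] of an ambient
   topological space [T]; utilities are total functions on [T], of which only
   the restriction to [decisions] matters. *)
Record game (R : realType) (T : topologicalType) (K M : finType) := Game {
  prior : K -> R;
  decisions : set T;
  sender_utility : K -> T -> R;
  receiver_utility : K -> T -> R;
  outside_option : K -> R;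
  types_nonempty : (0 < #|K|)%N;
  prior_dist : is_dist prior;
  prior_gt0 : forall k, 0 < prior k;
  enough_messages : (#|K| <= #|M|)%N;
  decisions_compact : compact decisions;
  sender_utility_continuous :
    forall k, {within decisions, continuous (sender_utility k)};
  receiver_utility_continuous :
    forall k, {within decisions, continuous (receiver_utility k)};
  acceptable_decision : forall k, exists2 x,
    decisions x & outside_option k <= sender_utility k x
}.

Section Equilibrium.
Context {R : realType} {T : topologicalType} {K M : finType}.
Variable G : game R T K M.

(* X(L): the decisions accepted by every type in L. *)
Definition accepted (L : {set K}) : set T :=
  [set x | decisions G x /\
     forall k, k \in L -> outside_option G k <= sender_utility G k x].

(* [sigma k m] is the probability sigma(m | k). *)
Definition sender_strategy (sigma : K -> M -> R) : Prop :=
  forall k, is_dist (sigma k).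

Definition receiver_strategy (tau : M -> T) : Prop :=
  forall m, decisions G (tau m).

Definition message_prob (sigma : K -> M -> R) (m : M) : R :=
  \sum_k prior G k * sigma k m.

(* Bayesian posterior; a junk value (zero) if [m] has probability zero. *)
Definition posterior (sigma : K -> M -> R) (m : M) (k : K) : R :=
  prior G k * sigma k m / message_prob sigma m.

Definition supp (q : K -> R) : {set K} := [set k | 0 < q k]%SET.

Definition argmax (A : set T) (f : T -> R) : set T :=
  [set x | A x /\ forall y, A y -> f y <= f x].

Definition incentive_compatible (sigma : K -> M -> R) (tau : M -> T) : Prop :=
  forall k m m', 0 < sigma k m ->
    sender_utility G k (tau m') <= sender_utility G k (tau m).

(* Rejection costs the receiver -oo and his expected utility has to be finite:
   after a message of positive probability he maximizes among the decisions
   that no type in the support of his belief rejects. *)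
Definition constrained_optimal (sigma : K -> M -> R) (tau : M -> T) : Prop :=
  forall m, 0 < message_prob sigma m ->
    accepted (supp (posterior sigma m)) !=set0 /\
    argmax (accepted (supp (posterior sigma m)))
      (fun x => \sum_k posterior sigma m k * receiver_utility G k x) (tau m).

Definition equilibrium (sigma : K -> M -> R) (tau : M -> T) : Prop :=
  [/\ sender_strategy sigma, receiver_strategy tau,
      incentive_compatible sigma tau & constrained_optimal sigma tau].

Definition pure (sigma : K -> M -> R) : Prop :=
  forall k, exists m, sigma k m = 1.

Definition partitional_equilibrium (sigma : K -> M -> R) (tau : M -> T) : Prop :=
  equilibrium sigma tau /\ pure sigma.

End Equilibrium.

(* Main.v *)
Require Import Defs.
From HB Require Import structures.
From mathcomp Require Import all_boot all_order all_algebra.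
From mathcomp Require Import all_classical all_reals all_analysis.

Set Implicit Arguments.
Unset Strict Implicit.
Unset Printing Implicit Defensive.

Import Order.TTheory GRing.Theory Num.Theory.
Import numFieldNormedType.Exports.
Local Open Scope classical_set_scope.
Local Open Scope ring_scope.

(** At most two messages are needed, because types whose utilities are
    monotonic in the same direction rank decisions alike, up to ties.  If some
    decision is acceptable to all types, let every type send the same message:
    the receiver learns nothing, makes a best reply [x] among the decisions
    that all types accept, and incentive compatibility is void once he answers
    every message by [x].

    Otherwise, let the nondecreasing types [I] send one message and the
    remaining types, all nonincreasing, send another one.  All types in [I]
    accept the largest decision and all types outside [I] accept the smallest
    one, so each group has a best reply, say [x] and [y].  The set X(I) is
    upward closed and X(~I) is downward closed, so [x <= y] would make [y]
    acceptable to all types.  Hence [y < x] ([separated_accepted]): the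
    nondecreasing types prefer [x], the nonincreasing ones prefer [y], and
    nobody gains by sending the message of the other group.

    Best replies exist because X(L) is a closed subset of a compact set and the
    expected utility of the receiver is continuous ([best_reply_exists]). *)

Section FiniteGame.
Context {R : realType} {T : topologicalType} {K M : finType}.
Variable G : game R T K M.

Lemma compact_accepted (L : {set K}) : compact (accepted G L).
Proof.
(* Acceptance by a type is closed relative to the decision space only, since
   utilities are continuous only there. *)
pose C : set (subspace (decisions G)) :=
  \bigcap_(k in [set` L])
     (sender_utility G k @^-1` [set u | outside_option G k <= u]).
have [V clV VC] : exists2 V : set T,
    closed V & V `&` decisions G = C `&` decisions G.
  apply/closed_subspaceP; apply: closed_bigI => k _.
  have /continuous_closedP := @sender_utility_continuous _ _ _ _ G k.
  by apply; exact: closed_ge.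
have -> : accepted G L = decisions G `&` V.
  by rewrite setIC VC; apply/seteqP; split => x [].
by apply: compact_closedI clV; exact: decisions_compact.
Qed.

Lemma continuous_expected_utility (q : K -> R) :
  {within decisions G, continuous
    (fun x => \sum_k q k * receiver_utility G k x)}.
Proof.
move=> x; apply: (cvg_big (op := +%R)) => [|k _]; first exact: add_continuous.
by apply: cvgM; [exact: cvg_cst | exact: receiver_utility_continuous].
Qed.

Lemma best_reply_exists (L : {set K}) (q : K -> R) :
  accepted G L !=set0 ->
  exists x, argmax (accepted G L)
    (fun x => \sum_k q k * receiver_utility G k x) x.
Proof.
move=> L0; have cont := @continuous_subspaceW _ _ (accepted G L) _ _
  (fun x => @proj1 _ _) (@continuous_expected_utility q).
have [x /set_mem Lx xmax] := compact_EVT_max L0 (@compact_accepted L) cont.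
by exists x; split => // y Ly; apply: xmax; exact: mem_set.
Qed.

Definition pure_strategy (f : K -> M) (k : K) (m : M) : R := (f k == m)%:R.

Lemma pure_strategy_sender (f : K -> M) : sender_strategy (pure_strategy f).
Proof.
move=> k; split=> [m|]; first exact: ler0n.
rewrite (bigD1 (f k)) //= big1 /pure_strategy ?eqxx ?addr0 // => m.
by rewrite eq_sym => /negbTE ->.
Qed.

Lemma message_prob_pure_gt0 (f : K -> M) (m : M) :
  0 < message_prob G (pure_strategy f) m <-> exists k, f k = m.
Proof.
split=> [Pm | [k <-]].
  have [k /eqP fk|nofk] := pickP (fun k => f k == m); first by exists k.
  by move: Pm; rewrite /message_prob big1 ?ltxx // => k _;
    rewrite /pure_strategy nofk mulr0.
have ge0 j : 0 <= prior G j * pure_strategy f j (f k).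
  by apply: mulr_ge0; [exact/ltW/prior_gt0 | exact: ler0n].
rewrite /message_prob (bigD1 k) //= ltr_wpDr ?sumr_ge0 //.
by rewrite /pure_strategy eqxx mulr1 prior_gt0.
Qed.

Lemma supp_posterior_pure (f : K -> M) (m : M) :
  supp (posterior G (pure_strategy f) m) = [set k | f k == m]%SET.
Proof.
apply/setP => k; rewrite !inE /posterior /pure_strategy.
have [fk|_] := eqVneq (f k) m; last by rewrite mulr0 mul0r ltxx.
rewrite mulr1 divr_gt0 ?prior_gt0 //.
by apply/message_prob_pure_gt0; exists k.
Qed.

(** For a pure strategy of the sender, the equilibrium conditions only concern
    the partition of the types into the fibres of [f]: a posterior is carried
    by the fibre of its message, and the messages of positive probability are
    those that some type sends. *)
Lemma pure_strategy_equilibrium (f : K -> M) (tau : M -> T) :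
  (forall m, decisions G (tau m)) ->
  (forall k m, sender_utility G k (tau m) <= sender_utility G k (tau (f k))) ->
  (forall k, argmax (accepted G [set j | f j == f k]%SET)
     (fun x => \sum_j posterior G (pure_strategy f) (f k) j
                      * receiver_utility G j x) (tau (f k))) ->
  partitional_equilibrium G (pure_strategy f) tau.
Proof.
move=> dec ic opt; split; last first.
  by move=> k; exists (f k); rewrite /pure_strategy eqxx.
split => //; first exact: pure_strategy_sender.
- move=> k m m'; rewrite /pure_strategy.
  by have [<- _|_] := eqVneq (f k) m; [exact: ic | rewrite ltxx].
- move=> m /message_prob_pure_gt0[k <-]; rewrite supp_posterior_pure.
  by split; [exists (tau (f k)); case: (opt k) | exact: opt].
Qed.

Lemma pooling_equilibrium : accepted G [set: K]%SET !=set0 ->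
  exists sigma tau, partitional_equilibrium G sigma tau.
Proof.
move=> acc.
have /card_gt0P[m _] : (0 < #|M|)%N.
  exact: leq_trans (types_nonempty G) (enough_messages G).
pose f := fun _ : K => m.
have [x [[dx ax] xmax]] :=
  best_reply_exists (posterior G (pure_strategy f) m) acc.
exists (pure_strategy f), (fun=> x).
apply: pure_strategy_equilibrium => // k; rewrite /f.
have -> : [set _ | m == m]%SET = [set: K]%SET.
  by apply/setP => j; rewrite !inE eqxx.
by split.
Qed.

(** The answer to the message of [~: I] also serves as the answer to the
    messages that nobody sends, so that these tempt no type. *)
Lemma two_message_equilibrium (I : {set K}) :
  (1 < #|M|)%N -> accepted G I !=set0 -> accepted G (~: I)%SET !=set0 ->
  (forall x y, accepted G I x -> accepted G (~: I)%SET y ->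
     forall k, if k \in I then sender_utility G k y <= sender_utility G k x
               else sender_utility G k x <= sender_utility G k y) ->
  exists sigma tau, partitional_equilibrium G sigma tau.
Proof.
move=> /card_gt1P[m1 [m2 [_ _ m12]]] I0 CI0 sep.
have m21 : (m2 == m1) = false by rewrite eq_sym (negbTE m12).
pose f k := if k \in I then m1 else m2.
have f1 : [set j | f j == m1]%SET = I.
  by apply/setP => j; rewrite inE /f; case: ifP; rewrite ?eqxx ?m21.
have f2 : [set j | f j == m2]%SET = (~: I)%SET.
  by apply/setP => j; rewrite !inE /f; case: ifP; rewrite ?eqxx ?(negbTE m12).
have [x [Ix xmax]] := best_reply_exists (posterior G (pure_strategy f) m1) I0.
have [y [Iy ymax]] := best_reply_exists (posterior G (pure_strategy f) m2) CI0.
exists (pure_strategy f), (fun m => if m == m1 then x else y).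
apply: pure_strategy_equilibrium => [m|k m|k].
- by case: ifP => _; [case: Ix | case: Iy].
- by have := sep _ _ Ix Iy k; rewrite /f /=; case: (k \in I);
    rewrite ?eqxx ?m21; case: (m == m1).
- have [->|->] : f k = m1 \/ f k = m2 by rewrite /f; case: ifP; [left | right].
    by rewrite f1 eqxx; split.
  by rewrite f2 m21; split.
Qed.

End FiniteGame.

Section RealDecisions.
Context {R : realType} {K M : finType}.
Variable G : game R R K M.

Lemma decisions_nonempty : decisions G !=set0.
Proof.
have /card_gt0P[k _] := types_nonempty G.
by have [x dx _] := acceptable_decision G k; exists x.
Qed.

Lemma accepted_nondecreasing (L : {set K}) :
  (forall k, k \in L ->
     {in decisions G &, nondecreasing_fun (sender_utility G k)}) ->
  accepted G L !=set0.
Proof.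
move=> mono.
have [b bX bmax] := compact_EVT_max decisions_nonempty
  (@decisions_compact _ _ _ _ G)
  (continuous_subspaceT (fun x : R => @cvg_id _ (nbhs x))).
exists b; split=> [|k kL]; first exact: set_mem.
have [x dx ux] := acceptable_decision G k; apply: (le_trans ux).
by apply: (mono k kL); [exact: mem_set | | apply: bmax; exact: mem_set].
Qed.

Lemma accepted_nonincreasing (L : {set K}) :
  (forall k, k \in L ->
     {in decisions G &, nonincreasing_fun (sender_utility G k)}) ->
  accepted G L !=set0.
Proof.
move=> mono.
have [a aX amin] := compact_EVT_min decisions_nonempty
  (@decisions_compact _ _ _ _ G)
  (continuous_subspaceT (fun x : R => @cvg_id _ (nbhs x))).
exists a; split=> [|k kL]; first exact: set_mem.
have [x dx ux] := acceptable_decision G k; apply: (le_trans ux).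
by apply: (mono k kL); [| exact: mem_set | apply: amin; exact: mem_set].
Qed.

(** X(I) is upward closed: with [x <= y], the decision [y] would be acceptable
    to the types in [I] as well as to the others. *)
Lemma separated_accepted (I : {set K}) (x y : R) :
  (forall k, k \in I ->
     {in decisions G &, nondecreasing_fun (sender_utility G k)}) ->
  ~ (accepted G [set: K]%SET !=set0) ->
  accepted G I x -> accepted G (~: I)%SET y -> y < x.
Proof.
move=> mono noacc [dx ax] [dy ay]; rewrite ltNge; apply/negP => xy.
apply: noacc; exists y; split => // k _.
have [kI|kNI] := boolP (k \in I); last by apply: ay; rewrite inE.
by apply: le_trans (ax k kI) _; apply: (mono k kI) => //; exact: mem_set.
Qed.

End RealDecisions.

Theorem proposition7 (R : realType) (K M : finType) (G : game R R K M)
    (X_interval : is_interval (decisions G))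
    (U_monotonic : forall k : K,
      {in decisions G &, nondecreasing_fun (sender_utility G k)} \/
      {in decisions G &, nonincreasing_fun (sender_utility G k)}) :
  exists (sigma : K -> M -> R) (tau : M -> R),
    partitional_equilibrium G sigma tau.
Proof.
have [acc|noacc] := pselect (accepted G [set: K]%SET !=set0).
  exact: pooling_equilibrium acc.
pose I := [set k | `[< {in decisions G &,
  nondecreasing_fun (sender_utility G k)} >]]%SET.
have up k : k \in I ->
    {in decisions G &, nondecreasing_fun (sender_utility G k)}.
  by rewrite inE => /asboolP.
have down k : k \notin I ->
    {in decisions G &, nonincreasing_fun (sender_utility G k)}.
  by rewrite inE => /asboolP nup; case: (U_monotonic k).
have M2 : (1 < #|M|)%N.
  apply: leq_trans (enough_messages G); rewrite ltnNge; apply/negP.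
  (* With a single type, the decision acceptable to it is acceptable to all. *)
  move=> /card_le1_eqP K1; apply: noacc.
  have /card_gt0P[k _] := types_nonempty G.
  have [x dx ux] := acceptable_decision G k.
  by exists x; split => // j _; rewrite (K1 k j).
apply: (two_message_equilibrium M2 (I := I)).
- exact: accepted_nondecreasing up.
- by apply: accepted_nonincreasing => k; rewrite inE; exact: down.
- move=> x y Ix Iy k; have /ltW yx := separated_accepted up noacc Ix Iy.
  have [/mem_set dx _] := Ix; have [/mem_set dy _] := Iy.
  by case: ifPn => [/up|/down]; apply.
Qed.
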